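(* The following are equivalent for a theory $T$ (with JCP, working in its monster model): (i) $T$ is stable; (ii) $R_{\phi,\psi}(x=x)<\omega$ for all contradictory formulas $\phi(x,y)$ and $\psi(x,y)$; (iii) every type is definable; (iv) $T$ is $\lambda$-stable for every infinite cardinal $\lambda$ with $\lambda^{|T|}=\lambda$.
   Context: Positive logic: formulas are built from atomic formulas with $\top,\bot,\wedge,\vee,\exists$; a theory is a consistent set of sentences $\forall x(\phi\to\psi)$ with $\phi,\psi$ positive; p.c. models are models such that every homomorphism from them into a model of $T$ reflects positive formulas. Standing assumption: $T$ has JCP and we work in a monster model $\mathfrak M$ (very saturated, very homogeneous p.c. model); all tuples and sets are small in $\mathfrak M$. $|T|$ is the number of formulas up to $T$-equivalence. $\operatorname{tp}(a/B)$ is the set of positive formulas with parameters in $B$ true of $a$; a type over $B$ is a set of this form. For an infinite cardinal $\lambda$, $T$ is $\lambda$-stable if for every $B$ with $|B|\le\lambda$ and every finite tuple of variables there are at most $\lambda$ types over $B$ in those variables; $T$ is stable if it is $\lambda$-stable for some $\lambda$. Formulas $\phi(x,y),\psi(x,y)$ are contradictory if $\phi\wedge\psi$ is inconsistent with $T$. For contradictory $\phi,\psi$, the rank $R_{\phi,\psi}$ on sets of formulas $\Sigma(x)$ (with parameters), valued in ordinals together with $-1$ and $\infty$, is the least function with: $R_{\phi,\psi}(\Sigma)\ge0$ if $\Sigma$ is consistent; $R_{\phi,\psi}(\Sigma)\ge\alpha+1$ if there is $b$ with $R_{\phi,\psi}(\Sigma\cup\{\phi(x,b)\})\ge\alpha$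 and $R_{\phi,\psi}(\Sigma\cup\{\psi(x,b)\})\ge\alpha$; $R_{\phi,\psi}(\Sigma)\ge\ell$ for limit $\ell$ if $R_{\phi,\psi}(\Sigma)\ge\alpha$ for all $\alpha<\ell$. For a type $p(x)$ over $B$ and a formula $\phi(x,y)$ without parameters, a $\phi$-definition of $p$ over $C$ is a set $\mathrm{d}_p\phi(y)$ of formulas over $C$ with $|\mathrm{d}_p\phi|\le|T|$ such that for all $b\in B$: $\phi(x,b)\in p$ iff $\models\mathrm{d}_p\phi(b)$. $p$ is definable if it has a $\phi$-definition over $B$ for every such $\phi$. *)

(* Defs.v *)
From HB Require Import structures.
From mathcomp Require Import all_boot.
From mathcomp Require Import boolp classical_sets functions cardinality.

Set Implicit Arguments.
Unset Strict Implicit.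
Unset Printing Implicit Defensive.

Local Open Scope classical_set_scope.
Local Open Scope card_scope.

(* Cardinals are represented by types, compared through [card_le]. *)
Definition card_lt T U (A : set T) (B : set U) : Prop :=
  (A #<= B) /\ ~ (B #<= A).
Notation "A '#<' B" := (card_lt A B) (at level 79) : card_scope.

Record signature := Signature {
  fsym : Type;
  rsym : Type;
  farity : fsym -> nat;
  rarity : rsym -> nat }.

Section Syntax.
Variable L : signature.

Inductive term (V : Type) : Type :=
  | Var of V
  | App (f : fsym L) of ('I_(farity f) -> term V).

(* [form V] is the type of positive formulas whose free variables are in [V];
   in [Ex phi], the bound variable is [None].  A formula phi(x, y) is an
   element of [form (X + Y)], and a formula with parameters in a set [B] of
   elements of a structure is an element of [form (X + B)]. *)
Inductive form (V : Type) : Type :=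
  | Equal of term V & term V
  | Rel (r : rsym L) of ('I_(rarity r) -> term V)
  | Top
  | Bot
  | And of form V & form V
  | Or of form V & form V
  | Ex of form (option V).

Fixpoint trename V W (s : V -> W) (t : term V) : term W :=
  match t with
  | Var v => Var (s v)
  | App f ts => App (fun i => trename s (ts i))
  end.

Fixpoint rename V W (s : V -> W) (phi : form V) : form W :=
  match phi with
  | Equal t u => Equal (trename s t) (trename s u)
  | Rel r ts => Rel (fun i => trename s (ts i))
  | Top => Top W
  | Bot => Bot W
  | And p q => And (rename s p) (rename s q)
  | Or p q => Or (rename s p) (rename s q)
  | Ex p => Ex (rename (omap s) p)
  end.

Definition inst X Y P (phi : form (X + Y)) (b : Y -> P) : form (X + P) :=
  rename (fun z => match z with inl x => inl x | inr y => inr (b y) end) phi.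

Record structure := Structure {
  carrier :> Type;
  carrier_inhabited : inhabited carrier;
  finterp : forall f : fsym L, ('I_(farity f) -> carrier) -> carrier;
  rinterp : forall r : rsym L, ('I_(rarity r) -> carrier) -> Prop }.

Fixpoint teval (N : structure) V (v : V -> N) (t : term V) : N :=
  match t with
  | Var x => v x
  | App f ts => finterp (fun i => teval v (ts i))
  end.

Definition ocons (N V : Type) (c : N) (v : V -> N) (o : option V) : N :=
  match o with Some x => v x | None => c end.

Fixpoint sat (N : structure) V (v : V -> N) (phi : form V) : Prop :=
  match phi with
  | Equal t u => teval v t = teval v u
  | Rel r ts => rinterp (fun i => teval v (ts i))
  | Top => True
  | Bot => False
  | And p q => sat v p /\ sat v q
  | Or p q => sat v p \/ sat v q
  | Ex p => exists c : N, sat (ocons c v) p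
  end.

Definition valsum (N X Y : Type) (a : X -> N) (b : Y -> N) (z : X + Y) : N :=
  match z with inl x => a x | inr y => b y end.

(* The sentence forall x (hyp x -> concl x). *)
Record hsentence := HSentence {
  hvars : nat;
  hyp : form 'I_hvars;
  concl : form 'I_hvars }.

Definition holds (N : structure) (s : hsentence) : Prop :=
  forall v : 'I_(hvars s) -> N, sat v (hyp s) -> sat v (concl s).

Record theory := Theory {
  axioms : set hsentence;
  theory_consistent : exists N : structure, forall s, axioms s -> holds N s }.

Definition model (T : theory) (N : structure) : Prop :=
  forall s, axioms T s -> holds N s.

Definition hom (N N' : structure) (h : N -> N') : Prop :=
  (forall f (a : 'I_(farity f) -> N), h (finterp a) = finterp (h \o a)) /\
  (forall r (a : 'I_(rarity r) -> N), rinterp a -> rinterp (h \o a)).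

Definition automorphism (N : structure) (h : N -> N) : Prop :=
  hom h /\ exists g : N -> N, [/\ hom g, cancel h g & cancel g h].

Definition pc_model (T : theory) (N : structure) : Prop :=
  model T N /\
  forall (N' : structure) (h : N -> N'), model T N' -> hom h ->
  forall n (phi : form 'I_n) (a : 'I_n -> N), sat (h \o a) phi -> sat a phi.

Definition JCP (T : theory) : Prop :=
  forall N1 N2 : structure, model T N1 -> model T N2 ->
  exists (N : structure) (h1 : N1 -> N) (h2 : N2 -> N),
    [/\ model T N, hom h1 & hom h2].

Definition equivalent (T : theory) V (phi psi : form V) : Prop :=
  forall N : structure, model T N -> forall v : V -> N, sat v phi <-> sat v psi.

Definition contradictory (T : theory) V (phi psi : form V) : Prop :=
  forall N : structure, model T N -> forall v : V -> N, ~ sat v (And phi psi).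

(* The set of formulas up to T-equivalence, in countably many variables:
   its cardinality is |T|. *)
Definition form_classes (T : theory) : set (set (form nat)) :=
  range (fun phi : form nat => [set psi | equivalent T phi psi]).

(* Finite satisfiability in [N] of a set of formulas in the variables [V]
   with parameters in [B]. *)
Definition consistent (N : structure) V (B : set N)
    (Sigma : set (form (V + B))) : Prop :=
  forall Delta : set (form (V + B)), finite_set Delta -> Delta `<=` Sigma ->
  exists a : V -> N, forall phi, Delta phi -> sat (valsum a val) phi.

(* Saturation and homogeneity are with respect to a cardinal [kappa]; a set
   is small when its cardinality is less than [kappa]. *)
Definition small (kappa : Type) U (A : set U) : Prop := A #< [set: kappa].

Definition saturated (kappa : Type) (N : structure) : Prop :=
  forall (V : Type) (B : set N) (Sigma : set (form (V + B))),
  small kappa [set: V] -> small kappa B -> consistent Sigma ->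
  exists a : V -> N, forall phi, Sigma phi -> sat (valsum a val) phi.

Definition homogeneous (kappa : Type) (N : structure) : Prop :=
  forall (V : Type) (a b : V -> N), small kappa [set: V] ->
  (forall phi : form V, sat a phi <-> sat b phi) ->
  exists h : N -> N, automorphism h /\ h \o a = b.

(* The cardinality of [kappa] exceeds 2 ^ (|T| + aleph_0): this lower bound is
   what "very" saturated and homogeneous amounts to. *)
Definition monster (T : theory) (kappa : Type) (M : structure) : Prop :=
  [/\ pc_model T M, small kappa [set: (form_classes T + nat)%type -> bool],
      saturated kappa M & homogeneous kappa M].

Section Monster.
Variables (T : theory) (M : structure).

Definition tp V (a : V -> M) (B : set M) : set (form (V + B)) :=
  [set phi | sat (valsum a val) phi].
Arguments tp {V} a B.

Definition types V (B : set M) : set (set (form (V + B))) :=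
  range (fun a : V -> M => tp a B).
Arguments types : clear implicits.

Definition lambda_stable (lambda : Type) : Prop :=
  forall B : set M, B #<= [set: lambda] ->
  forall n : nat, types 'I_n B #<= [set: lambda].

Definition infinite_cardinal (lambda : Type) : Prop :=
  infinite_set [set: lambda].

Definition stable (kappa : Type) : Prop :=
  exists lambda : Type, [/\ infinite_cardinal lambda,
    small kappa [set: lambda] & lambda_stable lambda].

Definition is_def V Y (B C : set M) (p : set (form (V + B)))
    (phi : form (V + Y)) (d : set (form (Y + C))) : Prop :=
  d #<= form_classes T /\
  forall b : Y -> B,
    p (inst phi b) <-> (forall theta, d theta -> sat (valsum (val \o b) val) theta).

Definition definable V (B : set M) (p : set (form (V + B))) : Prop :=
  forall (m : nat) (phi : form (V + 'I_m)),
  exists d : set (form ('I_m + B)), is_def p phi d.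

End Monster.
End Syntax.

Arguments Top {L V}.
Arguments Bot {L V}.
Arguments valsum {N X Y} a b z /.
Arguments types {L M} V B.
Arguments definable {L} T {M V B} p.
Arguments is_def {L} T {M V Y B C} p phi d.

(* [Osup f] is the least ordinal greater than all the [f i].  Equality of
   ordinals is [ole] in both directions, not Leibniz equality. *)
Inductive Ord : Type := Osup (I : Type) of (I -> Ord).

Fixpoint ole (a b : Ord) {struct a} : Prop :=
  match a, b with
  | @Osup _ f, @Osup _ g => forall i, exists j, ole (f i) (g j)
  end.

Definition olt (a b : Ord) : Prop :=
  match b with @Osup _ g => exists j, ole a (g j) end.

Definition ozero : Ord := Osup (fun e : void => match e with end).
Definition osucc (a : Ord) : Ord := Osup (fun _ : unit => a).
Definition omega : Ord := Osup (fun n : nat => iter n osucc ozero).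

Definition olimit (l : Ord) : Prop :=
  olt ozero l /\ forall a, olt a l -> olt (osucc a) l.

Lemma ole_refl a : ole a a.
Proof. by elim: a => I f IH /= i; exists i; exact: IH. Qed.

Lemma ole_trans b a c : ole a b -> ole b c -> ole a c.
Proof.
elim: b a c => J g IH [I f] [K h] /= fg gh i.
have [j fj] := fg i; have [k jk] := gh j; exists k; exact: IH fj jk.
Qed.

Lemma olt_le_trans b a c : olt a b -> ole b c -> olt a c.
Proof.
case: b c => J g [K h] /= [j aj] gh.
by have [k jk] := gh j; exists k; apply: ole_trans jk.
Qed.

Lemma ole_lt_trans b a c : ole a b -> olt b c -> olt a c.
Proof. by case: c => K h ab [k bk]; exists k; apply: ole_trans bk. Qed.

Lemma oltNle a b : ~ ole b a -> olt a b.
Proof.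
elim: b a => J g IH [I f] /= /existsNP[j /forallNP nj]; exists j => /=.
case gE: (g j) nj (IH j) => [K h] nj IHj i.
have := IHj (f i) (nj i); exact.
Qed.

Lemma oltW a b : olt a b -> ole a b.
Proof.
elim: b a => J g IH a [j agj]; apply: ole_trans agj _.
case gE: (g j) (IH j) => [K h] IHj k; exists j; rewrite gE.
by apply: IHj; exists k; apply: ole_refl.
Qed.

Lemma osucc_le a b : olt a b -> ole (osucc a) b.
Proof. by case: b => J g [j aj] _; exists j. Qed.

Lemma olt_succ a : olt a (osucc a).
Proof. by exists tt; apply: ole_refl. Qed.

Lemma olt_ind (P : Ord -> Prop) :
  (forall a, (forall b, olt b a -> P b) -> P a) -> forall a, P a.
Proof.
move=> H a; apply: (H); elim: a => I f IH b [i bi].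
by apply: H => c cb; apply: (IH i); apply: olt_le_trans bi.
Qed.

Inductive rank_value : Type := RNegOne | ROrd of Ord | RInfty.

Definition rle (u v : rank_value) : Prop :=
  match u, v with
  | RNegOne, _ | _, RInfty => True
  | ROrd a, ROrd b => ole a b
  | _, _ => False
  end.

Definition rlt (u v : rank_value) : Prop := rle u v /\ ~ rle v u.

Section Rank.
Variables (L : signature) (M : structure L) (X Y : Type).
Variables phi psi : form L (X + Y).

(* Sets of formulas in the variables [X] with arbitrary parameters. *)
Local Notation formset := (set (form L (X + [set: M]))).

Definition add_inst (Sigma : formset) (chi : form L (X + Y))
    (b : Y -> [set: M]) : formset := Sigma `|` [set inst chi b].

Definition rank_closed (R : formset -> rank_value) : Prop :=
  [/\ forall Sigma, consistent Sigma -> rle (ROrd ozero) (R Sigma),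
      forall Sigma a,
        (exists b, rle (ROrd a) (R (add_inst Sigma phi b)) /\
                   rle (ROrd a) (R (add_inst Sigma psi b))) ->
        rle (ROrd (osucc a)) (R Sigma)
    & forall Sigma l, olimit l ->
        (forall a, olt a l -> rle (ROrd a) (R Sigma)) ->
        rle (ROrd l) (R Sigma)].

Definition is_rank (R : formset -> rank_value) : Prop :=
  rank_closed R /\
  forall R', rank_closed R' -> forall Sigma, rle (R Sigma) (R' Sigma).

Fixpoint rank_ge (a : Ord) (Sigma : formset) : Prop :=
  match a with
  | @Osup _ f => consistent Sigma /\ forall i, exists b,
      rank_ge (f i) (add_inst Sigma phi b) /\
      rank_ge (f i) (add_inst Sigma psi b)
  end.

Lemma rank_ge_consistent a Sigma : rank_ge a Sigma -> consistent Sigma.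
Proof. by case: a => I f []. Qed.

Lemma rank_ge_le a b Sigma : ole a b -> rank_ge b Sigma -> rank_ge a Sigma.
Proof.
elim: a b Sigma => I f IH [J g] Sigma /= fg [cS gS]; split=> // i.
have [j fj] := fg i; have [b [gb1 gb2]] := gS j.
by exists b; split; apply: IH fj _.
Qed.

Lemma consistent_add Sigma chi b :
  consistent (add_inst Sigma chi b) -> consistent Sigma.
Proof. by move=> cS D fD DS; apply: cS => // chi' /DS; left. Qed.

Lemma rank_ge_succ a Sigma :
  rank_ge (osucc a) Sigma <->
  exists b, rank_ge a (add_inst Sigma phi b) /\ rank_ge a (add_inst Sigma psi b).
Proof.
split=> [[_ /(_ tt)] // | [b [b1 b2]]]; split; last by move=> _; exists b.
exact: consistent_add (rank_ge_consistent b1).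
Qed.

Lemma rank_value_exists Sigma : exists r, forall a, rank_ge a Sigma <-> rle (ROrd a) r.
Proof.
have [cS|ncS] := pselect (consistent Sigma); last first.
  by exists RNegOne => a; split=> // /rank_ge_consistent.
have [all|] := pselect (forall a, rank_ge a Sigma); first by exists RInfty.
move=> /existsNP[c0]; elim/olt_ind: c0 => c IH nc.
have [[d dc nd]|low] := pselect (exists2 d, olt d c & ~ rank_ge d Sigma).
  exact: IH dc nd.
case: c {IH} nc low => I f /= nc low.
have {nc} /existsNP[i ni] : ~ forall i, exists b,
    rank_ge (f i) (add_inst Sigma phi b) /\
    rank_ge (f i) (add_inst Sigma psi b) by move=> h; apply: nc.
have gei : rank_ge (f i) Sigma.
  by apply: contrapT => n; apply: low; exists (f i) => //; exists i; apply: ole_refl.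
exists (ROrd (f i)) => a; split=> [ga|/rank_ge_le]; last exact.
apply: contrapT => /oltNle/osucc_le/rank_ge_le/(_ ga)/rank_ge_succ; exact: ni.
Qed.

Lemma rank_exists : exists R, is_rank R.
Proof.
have [R RE] := choice rank_value_exists; exists R; split; first split.
- move=> S cS; apply/RE; split=> //; case.
- move=> S a [b [b1 b2]]; apply/RE/rank_ge_succ; exists b.
  by split; apply/RE.
- move=> S [I f] [[i _] lim] ltl; apply/RE.
  have succS j : rank_ge (osucc (f j)) S.
    by apply/RE/ltl/lim; exists j; apply: ole_refl.
  by split=> [|j]; [exact: rank_ge_consistent (succS i) | exact/rank_ge_succ].
move=> R' [R0 RS Rl] S.
have rleT r s t : rle r s -> rle s t -> rle r t.
  by case: r s t => [|a|] [|b|] [|c|] //=; apply: ole_trans.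
have main a : forall S', rank_ge a S' -> rle (ROrd a) (R' S').
  elim/olt_ind: a => a IH S' gS.
  have [nz|z] := pselect (olt ozero a); last first.
    apply: rleT (R0 _ (rank_ge_consistent gS)).
    by apply: contrapT => /oltNle.
  have [lim|] := pselect (forall b, olt b a -> olt (osucc b) a).
    apply: Rl => // b ba; apply: (IH _ ba).
    exact: rank_ge_le (oltW ba) gS.
  move=> /existsNP[b /not_implyP[ba nb]].
  have asb : ole a (osucc b) by apply: contrapT => /oltNle.
  have /rank_ge_succ[c [c1 c2]] := rank_ge_le (osucc_le ba) gS.
  apply: (rleT (ROrd a) (ROrd (osucc b)) _ asb); apply: RS; exists c.
  by split; apply: (IH _ ba).
case rE: (R S) => [|a|] //; first by apply: main; apply/RE; rewrite rE; apply: ole_refl.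
have R'all a : rle (ROrd a) (R' S) by apply: main; apply/RE; rewrite rE.
case: (R' S) R'all => [/(_ ozero)|b /(_ (osucc b))|] //.
have lt_irr : forall c, ~ olt c c.
  elim/olt_ind=> c IH cc; exact: (IH _ cc cc).
by move=> sb; case: (lt_irr b); exact: (@olt_le_trans (osucc b) _ _ (olt_succ b) sb).
Qed.

Definition rank : formset -> rank_value := projT1 (cid rank_exists).

Lemma rankP : is_rank rank.
Proof. exact: projT2 (cid rank_exists). Qed.

End Rank.

(* The formula x = x for a finite tuple x of variables. *)
Definition self_equal L n P : form L ('I_n + P) :=
  foldr (fun i chi => And (Equal (Var L (inl i)) (Var L (inl i))) chi) Top
    (enum 'I_n).

Arguments rank {L} M {X Y} phi psi _.

(* Main.v *)
(* (i) => (ii). If the rank is infinite, saturation yields, for a well-ordered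
   set D, a tree of parameters whose nodes are the pairs (x, A) with x in D and
   A a set of predecessors of x, and whose branches (the subsets of D) are all
   consistent. Taking D to be an initial segment of lambda that is minimal
   among those with more than lambda subsets, the tree has at most lambda nodes
   and its branches give more than lambda types over them.

   (ii) => (iii). In a p.c. model, the failure of phi is witnessed by some psi
   contradictory to phi. For each such psi, a formula theta of the type with
   least bound on its (phi, psi)-rank separates phi from psi: "theta(x) and
   phi(x, y) has the same rank as theta" is a positive formula in y. The
   phi-definition collects one such formula for each psi up to T-equivalence.
   The witness psi is obtained by compactness, here an ultrapower of the
   monster model indexed by its self-maps.

   (iii) => (iv). A type is determined by its definitions, of which there are
   at most lambda ^ |T|.  (iv) => (i). Take lambda = 2 ^ (|T| + aleph_0). *)
Require Import Defs.
From mathcomp Require Import all_boot.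
From mathcomp Require Import boolp classical_sets functions cardinality.
From mathcomp Require Import filter wochoice.

Set Implicit Arguments.
Unset Strict Implicit.
Unset Printing Implicit Defensive.

Local Open Scope classical_set_scope.
Local Open Scope card_scope.

(** * Cardinals *)

Lemma card_le_injP T U (A : set T) (B : set U) :
  A #<= B <-> exists f : A -> B, injective f.
Proof.
split=> [/card_leP/injfunPex[f _ finj]|[f finj]].
  by exists f => x y; apply: finj; rewrite inE.
by apply/card_leP/injfunPex; exists f => // x y _ _; exact: finj.
Qed.

Lemma card_leTP T U (A : set T) :
  A #<= [set: U] <-> exists f : A -> U, injective f.
Proof.
split=> [/card_le_injP[f finj]|[f finj]].
  by exists (fun x => val (f x)) => x y /val_inj /finj.
apply/card_le_injP; exists (fun x => SigSub (mem_set (I : setT (f x)))) => x y.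
by move=> [] /finj.
Qed.

Lemma card_le_typeP T U : [set: T] #<= [set: U] <-> exists f : T -> U, injective f.
Proof.
split=> [/card_leTP[f finj]|[f finj]].
  exists (fun x => f (SigSub (mem_set (I : setT x)))) => x y /finj.
  by move=> /(congr1 val).
by apply/card_leTP; exists (fun x => f (val x)) => x y /finj /val_inj.
Qed.

(** Trades an injection between subtypes for a total function on [T], which composes without
    membership proofs; [u] is its value off [A]. *)
Lemma card_le_fun T U (A : set T) (B : set U) : U -> A #<= B ->
  exists f : T -> U, (forall x, A x -> B (f x)) /\ set_inj A f.
Proof.
move=> u /card_le_injP[f finj].
exists (fun x => if pselect (A x) is left Ax then val (f (SigSub (mem_set Ax))) else u).
split=> [x Ax|x y /set_mem Ax /set_mem Ay].
  by case: pselect => // ?; exact/set_mem/valP.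
case: pselect => // {}Ax; case: pselect => // {}Ay.
by move=> /val_inj /finj /(congr1 val).
Qed.

Lemma card_image_le_inj T U (A : set T) (B : set U) (f : T -> U) :
  (forall x, A x -> B (f x)) -> (forall x y, A x -> A y -> f x = f y -> x = y) ->
  A #<= B.
Proof.
move=> fAB finj; apply/card_le_injP.
exists (fun x => SigSub (mem_set (fAB _ (set_mem (valP x))))) => x y [].
by move=> /finj -/(_ (set_mem (valP x)) (set_mem (valP y))) /val_inj.
Qed.

(** A maximal graph of a partial injection, given by Zorn's lemma, is total on one side: otherwise
    an unmatched [x] and an unmatched [y] could be paired. *)
Lemma card_le_total T U : [set: T] #<= [set: U] \/ [set: U] #<= [set: T].
Proof.
pose P (G : set (T * U)) := forall p q, G p -> G q -> p.1 = q.1 <-> p.2 = q.2.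
have [F FP Ftot|G [PG Gmax]] := @Zorn_bigcup _ P.
  move=> p q [X FX Xp] [Y FY Yq].
  by have [XY|YX] := Ftot _ _ FX FY; [apply: (FP _ FY)|apply: (FP _ FX)] => //;
    [exact: XY|exact: YX].
have [/choice[f Gf]|/existsNP[x /forallNP Gx]] := pselect (forall x, exists y, G (x, y)).
  left; apply/card_le_typeP; exists f => x y fxy.
  by have /= [_] := PG _ _ (Gf x) (Gf y); apply.
have [/choice[f Gf]|/existsNP[y /forallNP Gy]] := pselect (forall y, exists x, G (x, y)).
  right; apply/card_le_typeP; exists f => a b fab.
  by have /= [+ _] := PG _ _ (Gf a) (Gf b); apply.
have [] := Gmax (G `|` [set (x, y)]).
  split; first by left.
  by move=> /(_ (x, y)) H; apply: (Gx y); apply: H; right.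
move=> [a b] [c d] [Gab|[-> ->]] [Gcd|[-> ->]] //=.
- exact: (PG _ _ Gab Gcd).
- by split=> e; rewrite e in Gab; [case: (Gx b)|case: (Gy a)].
- by split=> e; rewrite -e in Gcd; [case: (Gx d)|case: (Gy c)].
Qed.

(* Zorn's lemma on the injections [A * A -> A] with [A] infinite. *)
Lemma card_square T : infinite_set [set: T] -> [set: T * T] #<= [set: T].
Proof.
move=> /infiniteP /card_le_typeP[e einj].
(* The domain [p.1] keeps [e 0] and [e 1] as two distinct tags, with which two disjoint copies of
   the domain are coded inside it. *)
pose inj_sq (p : set T * (T -> T -> T)) := [/\ p.1 (e 0), p.1 (e 1),
  forall x y, p.1 x -> p.1 y -> p.1 (p.2 x y) &
  forall x y z t, p.1 x -> p.1 y -> p.1 z -> p.1 t ->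
    p.2 x y = p.2 z t -> x = z /\ y = t].
pose S := {p | inj_sq p}.
pose R (p q : S) := `[< (sval p).1 `<=` (sval q).1 /\ forall x y,
   (sval p).1 x -> (sval p).1 y -> (sval p).2 x y = (sval q).2 x y >].
have [s0 _] : exists s : S, True.
  have /card_eqPle[/card_le_typeP[c cinj] _] := card_nat2.
  have [e' ee'] : exists e' : T -> nat, forall n, e' (e n) = n.
    have /choice[g gP] : forall x, exists n, forall m, e m = x -> m = n.
      move=> x; have [[m mx]|nm] := pselect (exists m, e m = x).
        by exists m => k kx; apply: einj; rewrite kx.
      by exists 0 => m mx; case: nm; exists m.
    by exists g => n; rewrite -(gP _ n).
  have sP : inj_sq (range e, fun x y => e (c (e' x, e' y))).
    split=> /=; [by exists 0|by exists 1|by move=> x y _ _; eexists|].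
    move=> _ _ _ _ [a _ <-] [b _ <-] [a' _ <-] [b' _ <-].
    by rewrite !ee' => /einj /cinj [-> ->].
  by exists (exist _ _ sP).
have [t|r s t /asboolP[rs rs2] /asboolP[st st2]|F Ftot|[[A f] [/= A0 A1 fA finj]] smax] := @ZL_preorder S s0 R.
- by apply/asboolP; split.
- apply/asboolP; split=> [x /rs /st//|x y rx ry].
  by rewrite rs2 // st2 //; apply: rs.
(* A nonempty chain is bounded by the union of its members, an empty one by [s0]. *)
- have [[s1 Fs1]|nF] := pselect (exists s, F s); last first.
    by exists s0 => s Fs; case: nF; exists s.
  have /choice[f fP] : forall xy : T * T, exists z, forall s, F s ->
      (sval s).1 xy.1 -> (sval s).1 xy.2 -> (sval s).2 xy.1 xy.2 = z.
    move=> [x y] /=.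
    have [[s [Fs [sx sy]]]|nF] := pselect (exists s, F s /\ (sval s).1 x /\ (sval s).1 y).
      exists ((sval s).2 x y) => t Ft tx ty.
      by have [/asboolP[_ ->]|/asboolP[_ ->]] := Ftot _ _ Fs Ft.
    by exists x => s Fs sx sy; case: nF; exists s.
  pose A := \bigcup_(s in F) (sval s).1.
  have common x y : A x -> A y -> exists s, [/\ F s, (sval s).1 x & (sval s).1 y].
    move=> [s Fs sx] [t Ft ty]; have [/asboolP[st _]|/asboolP[ts _]] := Ftot _ _ Fs Ft.
      by exists t; split=> //; apply: st.
    by exists s; split=> //; apply: ts.
  have sup s t : F s -> F t -> exists u, [/\ F u, (sval s).1 `<=` (sval u).1
      & (sval t).1 `<=` (sval u).1].
    move=> Fs Ft; have [/asboolP[st _]|/asboolP[ts _]] := Ftot _ _ Fs Ft.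
      by exists t; split=> // x.
    by exists s; split=> // x.
  have AP : inj_sq (A, fun x y => f (x, y)).
    split=> /=.
    - by have [] := svalP s1; exists s1.
    - by have [] := svalP s1; exists s1.
    - move=> x y Ax Ay; have [s [Fs sx sy]] := common _ _ Ax Ay.
      exists s => //; rewrite -(fP (x, y) s) //=.
      by have [_ _ + _] := svalP s; apply.
    - move=> x y z t Ax Ay Az At.
      have [s [Fs sx sy]] := common _ _ Ax Ay.
      have [s' [Fs' sz st]] := common _ _ Az At.
      have [u [Fu su s'u]] := sup _ _ Fs Fs'.
      rewrite -(fP (x, y) u) //=; [|exact: su|exact: su].
      rewrite -(fP (z, t) u) //=; [|exact: s'u|exact: s'u].
      by have [_ _ _ +] := svalP u; apply; [apply: su|apply: su|apply: s'u|apply: s'u].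
  exists (exist _ _ AP) => s Fs; apply/asboolP; split=> [x sx|x y sx sy] /=.
    by exists s.
  by rewrite -(fP (x, y) s).
have e01 : e 0 <> e 1 by move=> /einj.
(* As [A * A] embeds in [A] through [f], it suffices to embed [T] in [A]. *)
suff [g [gA ginj]] : exists g : T -> T, (forall x, A (g x)) /\ injective g.
  apply/card_le_typeP; exists (fun p => f (g p.1) (g p.2)) => -[x y] [z t] /=.
  by move=> /finj[]// /ginj -> /ginj ->.
(* If the complement of [A] embeds in [A], the tags place [A] and its complement side by side in
   [A]. Otherwise [h] gives a copy of [A] disjoint from [A], and [f] extends to the union, against
   maximality. *)
have [] := card_le_total (~` A) A; rewrite !(card_le_eql (card_setT _)) !(card_le_eqr (card_setT _)).
  move=> /(card_le_fun (e 0))[h [hA hinj]].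
  exists (fun x => if pselect (A x) then f (e 0) x else f (e 1) (h x)); split=> [x|x y].
    by case: pselect => Ax; apply: (fA) => //; apply: hA.
  case: pselect => Ax; case: pselect => Ay.
  - by move=> /finj[].
  - by move=> /finj[]//; apply: hA.
  - by move=> /finj[]//; [exact: hA|move=> /esym].
  - move=> /finj[]//; [exact: hA|exact: hA|move=> _].
    by apply: hinj; rewrite inE.
move=> /(card_le_fun (e 0))[h [hA hinj]]; exfalso.
pose A' := h @` A.
have [h' hK] : exists h' : T -> T, forall x, A x -> h' (h x) = x.
  have /choice[g gP] : forall x, exists n, forall m, A m -> h m = x -> m = n.
    move=> x; have [[m Am mx]|nm] := pselect (exists2 m, A m & h m = x).
      by exists m => k Ak kx; apply: hinj; rewrite ?inE // kx.
    by exists x => m Am mx; case: nm; exists m.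
  by exists g => x Ax; rewrite -(gP _ x).
pose tag x := if pselect (A x) then e 0 else e 1.
pose r x := if pselect (A x) then x else h' x.
(* A pair not contained in [A] is coded by its tags, which record the copy of each coordinate, and
   by the coordinates pulled back to [A]; [h] then moves the code away from the values of [f]. *)
pose f' x y := if pselect (A x /\ A y) then f x y
  else h (f (f (tag x) (tag y)) (f (r x) (r y))).
have tagA x : A (tag x) by rewrite /tag; case: pselect.
pose AA := A `|` A'.
have rh x : A x -> r (h x) = x.
  by move=> Ax; rewrite /r; case: pselect => [Ahx|nA] /=; [case: (hA _ Ax)|rewrite hK].
have rA x : AA x -> A (r x).
  case=> [Ax|[y Ay <-]]; last by rewrite rh.
  by rewrite /r; case: pselect.
have trinj x y : AA x -> AA y -> tag x = tag y -> r x = r y -> x = y.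
  have rx z : A z -> r z = z by rewrite /r; case: pselect.
  have tx z : A z -> tag z = e 0 by rewrite /tag; case: pselect.
  have th z : A z -> tag (h z) = e 1.
    by move=> Az; rewrite /tag; case: pselect => // Ahz; case: (hA _ Az).
  case=> [Ax|[x' Ax' <-]] [Ay|[y' Ay' <-]].
  - by rewrite !rx.
  - by rewrite tx // th.
  - by rewrite (tx y) // th // => /esym.
  - by rewrite !rh // => _ ->.
have codeA x y : AA x -> AA y -> A (f (f (tag x) (tag y)) (f (r x) (r y))).
  by move=> AAx AAy; apply: (fA); apply: (fA) => //; apply: rA.
have AAP : inj_sq (AA, f').
  split=> /=; [by left|by left| |].
    move=> x y AAx AAy; rewrite /f'; case: pselect => [[Ax Ay]|nA].
      by left; apply: (fA).
    by right; exists (f (f (tag x) (tag y)) (f (r x) (r y))) => //; apply: codeA.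
  move=> x y z t AAx AAy AAz AAt; rewrite /f'.
  case: pselect => [[Ax Ay]|nxy]; case: pselect => [[Az At]|nzt] /=.
  - exact: (finj).
  - by move=> E; case: (hA _ (codeA _ _ AAz AAt)); rewrite -E; apply: (fA).
  - by move=> E; case: (hA _ (codeA _ _ AAx AAy)); rewrite E; apply: (fA).
  - have rAx := rA _ AAx; have rAy := rA _ AAy.
    have rAz := rA _ AAz; have rAt := rA _ AAt.
    move=> /(hinj _ _ (mem_set (codeA _ _ AAx AAy)) (mem_set (codeA _ _ AAz AAt))).
    move=> /finj[]; try by do ?apply: (fA).
    by move=> /finj[]// tx ty /finj[]// rx ry; split; apply: trinj.
have /smax/asboolP[/= sub _] : R (exist inj_sq (A, f) (And4 A0 A1 fA finj)) (exist inj_sq (AA, f') AAP).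
  apply/asboolP; split=> [x Ax|x y Ax Ay] /=; first by left.
  by rewrite /f'; case: pselect => // nA; case: nA.
by apply: (hA _ A0); apply: sub; right; exists (e 0).
Qed.

Lemma card_le_prod T T' U U' : [set: T] #<= [set: T'] -> [set: U] #<= [set: U'] ->
  [set: T * U] #<= [set: T' * U'].
Proof.
move=> /card_le_typeP[f finj] /card_le_typeP[g ginj].
apply/card_le_typeP; exists (fun p => (f p.1, g p.2)) => -[x y] [z t] /= [].
by move=> /finj -> /ginj ->.
Qed.

Lemma card_le_prod_infinite (lambda : Type) T U : infinite_set [set: lambda] ->
  [set: T] #<= [set: lambda] -> [set: U] #<= [set: lambda] ->
  [set: T * U] #<= [set: lambda].
Proof.
move=> linf Tl Ul.
exact: card_le_trans (card_le_prod Tl Ul) (card_square linf).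
Qed.

Lemma card_le_ord (lambda : Type) n : infinite_set [set: lambda] ->
  [set: 'I_n] #<= [set: lambda].
Proof.
move=> /infiniteP; apply: card_le_trans.
by apply/card_le_typeP; exists val; exact: val_inj.
Qed.

(** The diagonal argument, through preimages under the injection [f]. Writing the power set as the
    subsets of [setT] matches the initial segments in [minimal_power]. *)
Lemma cantor T : ~ ([set A : set T | A `<=` setT] #<= [set: T]).
Proof.
move=> /card_leTP[f finj].
pose A := [set x | exists B, f B = x /\ ~ val B x].
have AT : [set A : set T | A `<=` setT] A by [].
pose A' : [set A : set T | A `<=` setT] := SigSub (mem_set AT).
have [nA|] := pselect (A (f A')); last by move=> H; apply: (H); exists A'.
by have [B [/finj -> ]] := nA; apply.
Qed.

Lemma well_founded_order T : exists lt : T -> T -> Prop,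
  (forall x y, lt x y -> ~ lt y x) /\
  forall A : set T, A !=set0 -> exists x, A x /\ forall y, A y -> y <> x -> lt x y.
Proof.
elim/Peq: T => T; have [R Rwo] := well_ordering_principle T.
have minP (A : set T) : A !=set0 -> exists x, A x /\ forall y, A y -> R x y.
  move=> [x Ax]; have [|z [[zA lb] _]] := Rwo (fun x => `[< A x >]).
    by exists x; apply/asboolP.
  by exists z; split=> [|y Ay]; [exact/asboolP|exact/lb/asboolP].
exists (fun x y => R x y /\ x <> y); split=> [x y [xy nxy] [yx _]|A /minP[x [Ax xmin]]].
  (* Antisymmetry comes from the uniqueness of least elements: both [x] and [y] are least in the
     pair they form. *)
  have [|z [_ zuniq]] := Rwo (fun u => (u == x) || (u == y)).
    by exists x; rewrite unfold_in eqxx.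
  have Rxx u : R u u.
    by have [|u' [-> ]] := minP [set u]; [exists u|apply].
  have zx : z = x.
    by apply: zuniq; split=> [|u]; rewrite unfold_in ?eqxx // => /orP[] /eqP ->.
  have zy : z = y.
    by apply: zuniq; split=> [|u]; rewrite unfold_in ?eqxx ?orbT // => /orP[] /eqP ->.
  by apply: nxy; rewrite -zx.
exists x; split=> // y Ay yx; split; first exact: xmin.
by move=> /esym.
Qed.

(** Serves finite satisfiability: each formula of a finite set comes with a finite list of levels,
    and one list covers them all. *)
Lemma finite_union_seq (I : Type) (W : eqType) (D : set I) (P : I -> seq W -> Prop) :
  finite_set D -> (forall i, D i -> exists F, P i F) ->
  exists l : seq W, forall i, D i -> exists F, P i F /\ {subset F <= l}.
Proof.
move=> fD DP; have /choice[g gP] : forall i, exists F, D i -> P i F.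
  move=> i; have [/DP[F PF]|nD] := pselect (D i); first by exists F.
  by exists [::].
have /finite_seqP[l lE] : finite_set (\bigcup_(i in D) [set` g i]).
  by apply: bigcup_finite => // i _; exact: finite_seq.
exists l => i Di; exists (g i); split; first exact: gP.
move=> x xi; have : [set` l] x by rewrite -lE; exists i.
by [].
Qed.

Lemma small_le (kappa : Type) T U (A : set T) (B : set U) :
  A #<= B -> small kappa B -> small kappa A.
Proof.
move=> AB [Bk kB]; split; first exact: card_le_trans AB Bk.
by move=> kA; apply: kB; exact: card_le_trans kA AB.
Qed.

Lemma card_le_arrow A A' K U : U -> [set: A] #<= [set: A'] -> [set: K] #<= [set: U] ->
  [set: A -> K] #<= [set: A' -> U].
Proof.
move=> u /card_le_typeP[f finj] /card_le_typeP[g ginj].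
have /choice[f' f'P] : forall a', exists o, forall a, f a = a' -> o = Some a.
  move=> a'; have [[a faa']|na] := pselect (exists a, f a = a').
    by exists (Some a) => b fba'; congr Some; apply: finj; rewrite faa'.
  by exists None => a faa'; case: na; exists a.
apply/card_le_typeP; exists (fun h a' => if f' a' is Some a then g (h a) else u).
move=> h h' E; apply/funext => a; apply: ginj.
by have := congr1 (fun k => k (f a)) E; rewrite (f'P _ a).
Qed.

Lemma card_le_seq (lambda : Type) B : infinite_set [set: lambda] ->
  [set: B] #<= [set: lambda] -> [set: seq B] #<= [set: lambda].
Proof.
move=> linf /card_le_typeP[g ginj].
have /card_le_typeP[f finj] := card_square linf.
have /infiniteP/card_le_typeP[e einj] := linf.
(* Sequences of different lengths may share a [code], so the length is recorded next to it. *)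
pose code := foldr (fun x c => f (g x, c)) (e 0).
apply/card_le_typeP; exists (fun s => f (e (size s), code s)).
move=> s s' /finj[/einj]; elim: s s' => [|x s IH] [|x' s'] //= [ss'].
by move=> /finj[/ginj -> /(IH _ ss') ->].
Qed.

(** Currying turns [C -> lambda] into [C * (C + nat) -> bool], and [C * (C + nat)] embeds in
    [C + nat]. The summand [nat] makes the exponent infinite even when [C] is finite. *)
Lemma card_arrow_pow (C : Type) : inhabited C ->
  let lambda := (C + nat)%type -> bool in
  infinite_set [set: lambda] /\ [set: C -> lambda] #= [set: lambda].
Proof.
move=> [c0] lambda; split.
  apply/infiniteP/card_le_typeP.
  exists (fun k z => if z is inr j then j == k else false) => j k.
  by move=> /(congr1 (fun f => f (inr j))); rewrite eqxx => /esym/eqP.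
apply/card_eqPle; split; last first.
  by apply/card_le_typeP; exists (fun f _ => f) => f f' /(congr1 (fun h => h c0)).
have Winf : infinite_set [set: (C + nat)%type].
  by apply/infiniteP/card_le_typeP; exists inr => j k [].
have CW : [set: C * (C + nat)] #<= [set: (C + nat)%type].
  apply: card_le_prod_infinite => //.
  by apply/card_le_typeP; exists inl => c c' [].
apply: card_le_trans (card_le_arrow true CW (card_lexx _)).
apply/card_le_typeP; exists (fun f z => f z.1 z.2) => f f' E.
by apply/funext => c; apply/funext => z; exact: (congr1 (fun h => h (c, z)) E).
Qed.

(** * Positive formulas *)

(** Renaming along [g] and evaluating along [b] brings a formula that depends only on [A] down to
    variables in an ordinal. *)
Lemma finite_retract V (A : set V) : finite_set A ->
  exists (k : nat) (b : 'I_k -> V) (g : V -> 'I_k), forall x, A x -> b (g x) = x.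
Proof.
have [[v0]|nV _] := pselect (inhabited V); last first.
  have b : 'I_0 -> V by case.
  have g : V -> 'I_0 by move=> v; case: nV.
  by exists 0, b, g => v; case: nV.
elim/Peq: V v0 A => V v0 A /finite_seqP[s ->].
(* The extra index, with value [v0], is where [g] sends the elements outside [s]. *)
exists (size s).+1, (fun i => nth v0 s i), (fun x => inord (index x s)) => x /= xs.
by rewrite inordK ?nth_index // ltnS index_size.
Qed.

Section Formulas.
Variable L : signature.

Lemma teval_rename (N : structure L) V W (s : V -> W) (v : W -> N) (t : term L V) :
  teval v (trename s t) = teval (v \o s) t.
Proof. by elim: t => [x|f ts IH] //=; congr finterp; apply/funext. Qed.

Lemma sat_rename (N : structure L) V (phi : form L V) :
  forall W (s : V -> W) (v : W -> N), sat v (rename s phi) <-> sat (v \o s) phi.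
Proof.
elim: phi => {V} [V t u|V r ts|V|V|V p IHp q IHq|V p IHp q IHq|V p IHp] W s v //=.
- by rewrite !teval_rename.
- by under eq_fun do rewrite teval_rename.
- by rewrite IHp IHq.
- by rewrite IHp IHq.
- have E c : ocons c v \o omap s = ocons c (v \o s) by apply/funext => -[].
  by split=> -[c] => [/IHp|]; rewrite ?E => cp; exists c => //; apply/IHp; rewrite E.
Qed.

Lemma sat_inst (N : structure L) X Y P (phi : form L (X + Y)) (b : Y -> P)
    (a : X -> N) (v : P -> N) :
  sat (valsum a v) (inst phi b) <-> sat (valsum a (v \o b)) phi.
Proof.
rewrite sat_rename; suff -> : valsum a v \o (fun z => match z with
    inl x => inl x | inr y => inr (b y) end) = valsum a (v \o b) by [].
by apply/funext => -[].
Qed.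

Lemma teval_hom (N N' : structure L) (h : N -> N') : hom h ->
  forall V (v : V -> N) (t : term L V), teval (h \o v) t = h (teval v t).
Proof.
move=> [hf _] V v; elim=> [x|f ts IH] //=.
by rewrite hf; congr finterp; apply/funext.
Qed.

Lemma sat_hom (N N' : structure L) (h : N -> N') : hom h ->
  forall V (phi : form L V) (v : V -> N), sat v phi -> sat (h \o v) phi.
Proof.
move=> hh V; elim=> {V} [V t u|V r ts|V|V|V p IHp q IHq|V p IHp q IHq|V p IHp] v //=.
- by rewrite !(teval_hom hh) => ->.
- under [in X in _ -> X]eq_fun do rewrite (teval_hom hh).
  by case: hh => _ hr /hr.
- by move=> [/IHp ? /IHq].
- by move=> [/IHp|/IHq]; [left|right].
- move=> [c /IHp hc]; exists (h c).
  suff <- : h \o ocons c v = ocons (h c) (h \o v) by [].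
  by apply/funext => -[].
Qed.

Lemma teval_finite V (t : term L V) : exists A : set V, finite_set A /\
  forall (N : structure L) (v v' : V -> N),
    (forall x, A x -> v x = v' x) -> teval v t = teval v' t.
Proof.
elim: t => [x|f ts /choice[A AP]] /=.
  by exists [set x]; split=> [|N v v' vv']; [exact: finite_set1|exact: vv'].
exists (\bigcup_(i in [set: 'I_(farity f)]) A i); split.
  by apply: bigcup_finite => [|i _]; [exact: finite_finset|case: (AP i)].
move=> N v v' vv'; congr finterp; apply/funext => i.
by apply: (AP i).2 => x Ax; apply: vv'; exists i.
Qed.

Lemma sat_finite V (phi : form L V) : exists A : set V, finite_set A /\
  forall (N : structure L) (v v' : V -> N),
    (forall x, A x -> v x = v' x) -> sat v phi <-> sat v' phi.
Proof.
elim: phi => {V} [V t u|V r ts|V|V|V p [A [fA AP]] q [B [fB BP]]|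
    V p [A [fA AP]] q [B [fB BP]]|V p [A [fA AP]]] /=.
- have [A [fA AP]] := teval_finite t; have [B [fB BP]] := teval_finite u.
  exists (A `|` B); split=> [|N v v' vv']; first by rewrite finite_setU.
  by rewrite (AP _ v v') ?(BP _ v v') // => x ?; apply: vv'; [right|left].
- have /choice[A AP] := fun i => teval_finite (ts i).
  exists (\bigcup_(i in [set: 'I_(rarity r)]) A i); split.
    by apply: bigcup_finite => [|i _]; [exact: finite_finset|case: (AP i)].
  move=> N v v' vv'; suff -> : (fun i => teval v (ts i)) = (fun i => teval v' (ts i)) by [].
  by apply/funext => i; apply: (AP i).2 => x Ax; apply: vv'; exists i.
- by exists set0; split=> //; exact: finite_set0.
- by exists set0; split=> //; exact: finite_set0.
- exists (A `|` B); split=> [|N v v' vv']; first by rewrite finite_setU.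
  by rewrite (AP _ v v') ?(BP _ v v') // => x ?; apply: vv'; [right|left].
- exists (A `|` B); split=> [|N v v' vv']; first by rewrite finite_setU.
  by rewrite (AP _ v v') ?(BP _ v v') // => x ?; apply: vv'; [right|left].
- exists (Some @^-1` A); split=> [|N v v' vv'].
    by apply: finite_preimage => // x y _ _ [].
  have E c : sat (ocons c v) p <-> sat (ocons c v') p.
    by apply: AP => -[x|] // Ax; apply: vv'.
  by split=> -[c] /E; exists c.
Qed.

Lemma form_finite_params X B (phi : form L (X + B)) :
  exists (k : nat) (phi' : form L (X + 'I_k)) (b : 'I_k -> B),
    forall (N : structure L) (a : X -> N) (v : B -> N),
      sat (valsum a v) phi <-> sat (valsum a (v \o b)) phi'.
Proof.
have [A [fA AP]] := sat_finite phi.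
have /finite_retract[k [b [g bg]]] : finite_set (inr @^-1` A : set B).
  by apply: finite_preimage => // x y _ _ [].
exists k, (inst phi g), b => N a v; rewrite sat_inst; apply: AP => -[x|x] //= Ax.
by rewrite bg.
Qed.

Lemma form_finite_vars V Y (phi : form L (V + Y)) :
  exists (k : nat) (phi' : form L ('I_k + Y)) (s : 'I_k -> V),
    forall (N : structure L) (a : V -> N) (v : Y -> N),
      sat (valsum a v) phi <-> sat (valsum (a \o s) v) phi'.
Proof.
pose swap A B (z : A + B) := match z with inl x => inr x | inr y => inl y end.
have satE (N : structure L) A B (chi : form L (A + B)) (a : B -> N) (b : A -> N) :
    sat (valsum a b) (rename (@swap A B) chi) <-> sat (valsum b a) chi.
  rewrite sat_rename; suff -> : valsum a b \o @swap A B = valsum b a by [].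
  by apply/funext => -[].
have [k [phi' [s phiE]]] := form_finite_params (rename (@swap V Y) phi).
exists k, (rename (@swap Y 'I_k) phi'), s => N a v.
by rewrite satE -phiE satE.
Qed.

Fixpoint Exs n (P : Type) : form L ('I_n + P) -> form L P :=
  match n with
  | 0 => rename (fun z : 'I_0 + P => match z with inl i => False_rect P (notF (ltn_ord i))
                                     | inr y => y end)
  | n'.+1 => fun phi => Ex (Exs (rename (fun z : 'I_n'.+1 + P => match z with
      | inl i => if unlift ord0 i is Some j then inl j else inr None
      | inr y => inr (Some y) end) phi))
  end.

Lemma sat_Exs (N : structure L) n P (phi : form L ('I_n + P)) (v : P -> N) :
  sat v (Exs phi) <-> exists a, sat (valsum a v) phi.
Proof.
elim: n P phi v => [|n IH] P phi v /=.
  rewrite sat_rename; set w := _ \o _.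
  have wE a : valsum a v = w by apply/funext => -[[]|].
  split=> [phiw|[a]]; last by rewrite wE.
  have a : 'I_0 -> N by case.
  by exists a; rewrite wE.
split=> [[c /IH[a]]|[a phia]]; rewrite ?sat_rename.
  set w := _ \o _ => phiw.
  exists (fun i => if unlift ord0 i is Some j then a j else c).
  suff -> : valsum (fun i => if unlift ord0 i is Some j then a j else c) v = w by [].
  by apply/funext => -[i|y] //=; rewrite /w /=; case: (unlift ord0 i).
exists (a ord0); apply/IH; exists (a \o lift ord0); rewrite sat_rename.
suff -> : valsum (a \o lift ord0) (ocons (a ord0) v) \o (fun z => match z with
      | inl i => if unlift ord0 i is Some j then inl j else inr None
      | inr y => inr (Some y) end) = valsum a v by [].
by apply/funext => -[i|y] //=; case: unliftP => [j ->|->].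
Qed.

Definition Ands V (I : Type) (s : seq I) (F : I -> form L V) : form L V :=
  foldr (fun i => And (F i)) Top s.

Lemma sat_Ands (N : structure L) V (I : eqType) (s : seq I) (F : I -> form L V)
    (v : V -> N) :
  sat v (Ands s F) <-> forall i, i \in s -> sat v (F i).
Proof.
elim: s => [|i s IH] /=; first by split.
rewrite IH; split=> [[Fi Fs] j|H].
  by rewrite in_cons => /orP[/eqP->|/Fs].
by split=> [|j js]; apply: H; rewrite in_cons ?eqxx // js orbT.
Qed.

End Formulas.

(** * Ultrapowers and p.c. models *)

(** The representatives [repr] let the ultrapower interpret symbols without any check of
    compatibility. *)
Lemma quotient_exists X (E : X -> X -> Prop) :
  (forall x, E x x) -> (forall x y, E x y -> E y x) ->
  (forall x y z, E x y -> E y z -> E x z) ->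
  exists (Q : Type) (pi : X -> Q) (repr : Q -> X),
    cancel repr pi /\ forall x y, pi x = pi y <-> E x y.
Proof.
move=> Er Es Et; pose Q := {A : set X | exists x, A = E x}.
pose pi x : Q := exist _ (E x) (ex_intro _ x erefl).
have piE x y : pi x = pi y <-> E x y.
  split=> [/(congr1 sval)/= Exy|Exy]; first by rewrite Exy.
  apply: eq_exist; apply/seteqP; split=> z /=; first exact/Et/Es.
  exact: Et.
have /choice[repr reprE] : forall q : Q, exists x, pi x = q.
  by move=> [A [x Ax]]; exists x; apply: eq_exist; rewrite Ax.
by exists Q, pi, repr; split.
Qed.

Section Ultrapower.
Variables (L : signature) (N : structure L) (I : Type) (U : set_system I).
Hypothesis UU : UltraFilter U.

Let UF : ProperFilter U := ultra_proper.

(** The theorem of Los for positive formulas. Disjunction uses that [U] is ultra, the quantifier a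
    choice of witnesses at each index, and atomic formulas that arities are finite. *)
Lemma ultrapower_exists : exists (N' : structure L) (pi : (I -> N) -> N'),
  (forall q, exists x, pi x = q) /\
  forall V (phi : form L V) (v : V -> I -> N),
    sat (pi \o v) phi <-> U [set i | sat (v ^~ i) phi].
Proof.
pose E (x y : I -> N) := U [set i | x i = y i].
have [||x y z xy yz|Q [pi [repr [piK piE]]]] := @quotient_exists _ E.
- by move=> x; apply: filterS filterT.
- by move=> x y; apply: filterS.
- by apply: filterS2 xy yz => i /= ->.
have N0 : inhabited Q.
  by have [c] := carrier_inhabited N; exists; exact: pi (fun=> c).
pose fQ f (a : 'I_(farity f) -> Q) := pi (fun i => finterp (fun j => repr (a j) i)).
pose rQ r (a : 'I_(rarity r) -> Q) := U [set i | rinterp (fun j => repr (a j) i)].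
pose N' := @Structure L Q N0 fQ rQ.
have reprE x : U [set i | repr (pi x) i = x i] by apply/piE; rewrite piK.
have los_term V (t : term L V) (v : V -> I -> N) :
    teval (pi \o v : V -> N') t = pi (fun i => teval (v ^~ i) t).
  elim: t => [//|f ts IH] /=; apply/piE.
  have /(filter_forall _) := fun j => reprE (fun i => teval (v ^~ i) (ts j)).
  apply: filterS => i ij; congr finterp; apply/funext => j.
  by rewrite -ij -IH.
exists N', pi; split=> [q|V phi]; first by exists (repr q).
elim: phi => {V} [V t u|V r ts|V|V|V p IHp q IHq|V p IHp q IHq|V p IHp] v /=.
- by rewrite !los_term; exact: piE.
- rewrite /rQ.
  have /(filter_forall _) Uj := fun j => reprE (fun i => teval (v ^~ i) (ts j)).
  have Er i : (forall j, repr (pi (fun i => teval (v^~ i) (ts j))) i = teval (v^~ i) (ts j)) ->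
      (fun j => repr (teval (pi \o v : V -> N') (ts j)) i) = (fun j => teval (v ^~ i) (ts j)).
    by move=> ij; apply/funext => j; rewrite los_term.
  by split; apply: filterS2 Uj => i /Er Ei /=; rewrite Ei.
- by split=> // _; apply: filterS filterT.
- split=> // U0; case: (@filter_not_empty _ U UF).
  by apply: filterS U0.
- rewrite IHp IHq; split=> [[pU qU]|pqU]; first exact: filterI.
  by split; apply: filterS pqU => i [].
- rewrite IHp IHq; split=> [[]|pqU]; [by apply: filterS => i; left|by apply: filterS => i; right|].
  have [|nU] := in_ultra_setVsetC [set i | sat (v^~ i) p] UU; first by left.
  by right; apply: filterS2 pqU nU => i [].
- have E' (c : I -> N) : ocons (pi c) (pi \o v) = pi \o (ocons c v).
    by apply/funext => -[].
  have E2 (c : I -> N) i : ocons (c i) (v^~ i) = (ocons c v)^~ i.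
    by apply/funext => -[].
  split=> [[c]|].
    rewrite -(piK c) E' IHp; apply: filterS => i pi'; exists (repr c i).
    by rewrite E2.
  move=> Ui; have [n0] := carrier_inhabited N.
  have /choice[c cP] : forall i, exists c, (exists c, sat (ocons c (v^~ i)) p) ->
      sat (ocons c (v^~ i)) p.
    move=> i; have [[c pc]|nc] := pselect (exists c, sat (ocons c (v^~ i)) p).
      by exists c.
    by exists n0 => /nc.
  exists (pi c); rewrite E' IHp; apply: filterS Ui => i /cP.
  by rewrite E2.
Qed.

End Ultrapower.

Section Contradictory.
Variables (L : signature) (T : theory L) (M : structure L).
Hypotheses (hJCP : JCP T) (pcM : pc_model T M).

(** By JCP, [M] and [N] map to a common model, where the existential closure of [phi] holds. The
    p.c. property, applied to the empty tuple, reflects it to [M]. *)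
Lemma pc_model_sat n (phi : form L 'I_n) (N : structure L) (v : 'I_n -> N) :
  model T N -> sat v phi -> exists a : 'I_n -> M, sat a phi.
Proof.
move=> TN phiv; have [TM Mpc] := pcM.
have [N' [h1 [h2 [TN' hh1 hh2]]]] := hJCP TM TN.
pose chi : form L 'I_0 := Exs (rename (@inl 'I_n 'I_0) phi).
have e : 'I_0 -> M by case.
have : sat (h1 \o e) chi.
  by apply/sat_Exs; exists (h2 \o v); rewrite sat_rename; exact: sat_hom.
move=> /(Mpc _ _ TN' hh1) /sat_Exs[a]; rewrite sat_rename; by exists a.
Qed.

(** Otherwise each positive formula true of [a] is realized together with [phi]. By compactness some
    homomorphism from [M] to a model sends [a] to a realization of [phi], which the p.c. property
    reflects. *)
Lemma pc_model_contradictory_ord n (phi : form L 'I_n) (a : 'I_n -> M) :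
  ~ sat a phi -> exists psi, contradictory T phi psi /\ sat a psi.
Proof.
move=> nphi; apply: contrapT => /forallNP npsi; have [TM Mpc] := pcM.
have consis psi : sat a psi -> exists c : 'I_n -> M, sat c phi /\ sat c psi.
  move=> psia; apply: contrapT => /forallNP nc; apply: (npsi psi); split=> // N TN v pp.
  have [c pc] := pc_model_sat TN pp; exact: (nc c).
have [m0] := carrier_inhabited M.
(* A map [m] is an assignment for formulas whose variables are the elements of [M], and [D] is the
   positive diagram of [M]. *)
pose B (chi : form L M) := [set m : M -> M | sat m chi /\ sat (m \o a) phi].
pose D (chi : form L M) := sat id chi.
have FB : Filter (filter_from D B).
  apply: filter_from_filter; first by exists Top.
  by move=> p q Dp Dq; exists (And p q) => // m [[]].
have PF : ProperFilter (filter_from D B).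
  apply: filter_from_proper => // chi Dchi.
  have [A [fA AP]] := sat_finite chi.
  have /finite_retract[k [b [g bg]]] : finite_set (A `|` range a).
    by rewrite finite_setU; split=> //; apply: finite_image; exact: finite_finset.
  (* [psi] says of a tuple that some assignment satisfying [chi] takes its values at the coordinates
     of [a]. The assignment [id] shows that [a] satisfies it; a common realization with [phi] yields
     a member of [B chi]. *)
  pose psi := Exs (And (rename (fun x => @inl 'I_k 'I_n (g x)) chi)
    (Ands (enum 'I_n) (fun i => Equal (Var L (inr i)) (Var L (inl (g (a i))))))).
  have /consis[c [phic /sat_Exs[y [chiy /sat_Ands eqs]]]] : sat a psi.
    apply/sat_Exs; exists b; split.
      by rewrite sat_rename; have [_ +] := AP M (b \o g) id (fun x Ax => bg x (or_introl Ax)); apply.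
    by apply/sat_Ands => i _ /=; rewrite bg //; right; exists i.
  exists (y \o g); split; first by move: chiy => /sat_rename.
  suff -> : (y \o g) \o a = c by [].
  by apply/funext => i; have := eqs i; rewrite mem_enum => /(_ isT) /= ->.
have [U [UU FU]] := ultraFilterLemma PF.
have UF : ProperFilter U := ultra_proper.
have UD chi : D chi -> U (fun m => sat m chi).
  by move=> Dchi; apply: FU; exists chi => // m [].
have [N' [pi [pi_surj los]]] := @ultrapower_exists L M _ U UU.
(* The class of evaluation at [x], not the diagonal map. The diagram holds at [U]-almost every [m],
   so [h] is a homomorphism. *)
pose h (x : M) := pi (fun m => m x).
have los' V (v : V -> M) (chi : form L V) :
    sat (h \o v) chi <-> U (fun m => sat (m \o v) chi).
  exact: (los _ _ (fun x m => m (v x))).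
have hD chi : D chi -> sat h chi by move=> /UD Uchi; apply/(los' _ id).
have TN' : model T N'.
  move=> s Ts v; have /choice[r rE] : forall j, exists x, pi x = v j by [].
  have -> : v = pi \o r by apply/funext => j /=.
  move=> /los Uh; apply/los; apply: filterS Uh => m; exact: TM.
have hh : hom h.
  split=> [f e|r e re].
    by have := hD (Equal (App (fun j => Var L (e j))) (Var L (finterp e))); move=> /= ->.
  exact: (hD (Rel (fun j => Var L (e j)))).
apply: nphi; apply: (Mpc N' h TN' hh); apply/los'.
by apply: FU; exists Top => // m [].
Qed.

Lemma pc_model_contradictory n m (phi : form L ('I_n + 'I_m)) (v : 'I_n + 'I_m -> M) :
  ~ sat v phi -> exists psi, contradictory T phi psi /\ sat v psi.
Proof.
move=> nphi; have splitK : cancel (@unsplit n m) (@fintype.split n m) := @unsplitK n m.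
have [|psi [ctr psiv]] := @pc_model_contradictory_ord _ (rename (@unsplit n m) phi) (v \o @fintype.split n m).
  rewrite sat_rename; suff -> : (v \o @fintype.split n m) \o @unsplit n m = v by [].
  by apply/funext => z /=; rewrite splitK.
exists (rename (@fintype.split n m) psi); split; last by rewrite sat_rename.
move=> N TN w [/= phiw /sat_rename psiw]; apply: (ctr N TN (w \o @fintype.split n m)).
split=> //; rewrite sat_rename.
suff -> : (w \o @fintype.split n m) \o @unsplit n m = w by [].
by apply/funext => z /=; rewrite splitK.
Qed.

End Contradictory.

(** * The rank *)

Section RankFinite.
Variables (L : signature) (M : structure L) (X Y : Type).
Variables phi psi : form L (X + Y).
Local Notation ord k := (iter k osucc ozero).

Lemma rle_trans u v w : rle u v -> rle v w -> rle u w.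
Proof. by case: u v w => [|a|] [|b|] [|c|] //=; apply: ole_trans. Qed.

(** The function read off [rank_ge] is closed, so it bounds the least closed function [rank] from
    above. *)
Lemma rank_geE (a : Ord) (Sigma : set (form L (X + [set: M]))) :
  rle (ROrd a) (rank M phi psi Sigma) -> rank_ge phi psi a Sigma.
Proof.
have [_ rank_min] := @rankP L M X Y phi psi.
have [R RE] := choice (rank_value_exists phi psi (M := M)).
move=> ar; apply/RE; apply: rle_trans ar _; apply: rank_min.
split=> [S cS|S b [c [c1 c2]]|S [I f] [[i _] lim] ltl].
- by apply/RE; split=> //; case.
- by apply/RE/rank_ge_succ; exists c; split; apply/RE.
- apply/RE.
  have succS j : rank_ge phi psi (osucc (f j)) S.
    by apply/RE/ltl/lim; exists j; apply: ole_refl.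
  by split=> [|j]; [exact: rank_ge_consistent (succS i)|exact/rank_ge_succ].
Qed.

Lemma rank_ge_ord k (Sigma : set (form L (X + [set: M]))) :
  rank_ge phi psi (ord k) Sigma -> rle (ROrd (ord k)) (rank M phi psi Sigma).
Proof.
have [[rank0 rankS _] _] := @rankP L M X Y phi psi.
elim: k Sigma => [|k IH] S; first by move=> /rank_ge_consistent /rank0.
by move=> /rank_ge_succ[b [b1 b2]]; apply: rankS; exists b; split; exact: IH.
Qed.

Lemma olimit_omega : olimit omega.
Proof.
split=> [|a [k ak]]; first by exists 0; exact: ole_refl.
by exists k.+1 => /= _; exists tt.
Qed.

Lemma rank_lt_omega (Sigma : set (form L (X + [set: M]))) :
  rlt (rank M phi psi Sigma) (ROrd omega) <->
  exists k, ~ rank_ge phi psi (ord k) Sigma.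
Proof.
have [[_ _ ranklim] _] := @rankP L M X Y phi psi.
split=> [[_ nle]|[k nk]].
  apply: contrapT => /forallNP allk; apply: nle; apply: ranklim => [|a [k ak]].
    exact: olimit_omega.
  apply: (@rle_trans (ROrd a) (ROrd (ord k)) _ ak); apply: rank_ge_ord.
  by apply: contrapT => nk; exact: (allk k).
have nw : ~ rle (ROrd omega) (rank M phi psi Sigma).
  move=> /rank_geE gw; apply: nk; apply: rank_ge_le gw.
  by apply: oltW; exists k; exact: ole_refl.
split=> //; case: (rank M phi psi Sigma) nw => [|a|] nw; [by []|exact: oltW (oltNle nw)|by case: nw].
Qed.

(* The rank on definable sets, computed on their sets of realizations. *)
Fixpoint rank_ge_on (k : nat) (S : set (X -> M)) : Prop :=
  match k with
  | 0 => S !=set0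
  | k'.+1 => exists b : Y -> M,
      rank_ge_on k' (S `&` [set a | sat (valsum a b) phi]) /\
      rank_ge_on k' (S `&` [set a | sat (valsum a b) psi])
  end.

Definition realizations V (B : set M) (Sigma : set (form L (V + B))) :=
  [set a : V -> M | forall chi, Sigma chi -> sat (valsum a val) chi].

(** For finite [Sigma], consistency is realizability, and adding an instance keeps the set
    finite. *)
Lemma rank_ge_realizations k (Sigma : set (form L (X + [set: M]))) :
  finite_set Sigma ->
  rank_ge phi psi (ord k) Sigma <-> rank_ge_on k (realizations Sigma).
Proof.
have realD S chi b : realizations (add_inst S chi b) =
    realizations S `&` [set a | sat (valsum a (val \o b)) chi].
  apply/seteqP; split=> a /= => [Sa|[Sa chia] th [/Sa//|->]].
    by split=> [th Sth|]; [apply: Sa; left|apply/sat_inst/Sa; right].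
  exact/sat_inst.
elim: k Sigma => [|k IH] S fS.
  split=> [[cS _]|[a aS]]; first by have [a aS] := cS S fS (fun _ => id); exists a.
  by split=> [|[]] // D fD DS; exists a => chi /DS; exact: aS.
have IH' chi b : rank_ge phi psi (ord k) (add_inst S chi b) <->
    rank_ge_on k (realizations S `&` [set a | sat (valsum a (val \o b)) chi]).
  by rewrite IH -?realD // finite_setU; split=> //; exact: finite_set1.
rewrite -[ord k.+1]/(osucc (ord k)) rank_ge_succ; split=> -[b].
  by rewrite !IH'; exists (val \o b).
move=> bS; exists (fun y => SigSub (mem_set (I : setT (b y)))).
by rewrite !IH'.
Qed.

End RankFinite.

Section Definability.
Variables (L : signature) (M : structure L) (n m : nat).
Variables phi psi : form L ('I_n + 'I_m).

(** Existential quantifiers over the splitting parameters make rank at least [k] a positive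
    condition on the parameters of [theta]. Each round adds a tuple of parameters, so [Z] varies in
    the recursion. *)
Fixpoint rank_form k Z (theta : form L ('I_n + Z)) : form L Z :=
  match k with
  | 0 => Exs theta
  | k'.+1 =>
    let add (chi : form L ('I_n + 'I_m)) : form L ('I_n + ('I_m + Z)) :=
      And (inst theta inr) (inst chi inl) in
    Exs (And (rank_form k' (add phi)) (rank_form k' (add psi)))
  end.

Lemma sat_rank_form k Z (theta : form L ('I_n + Z)) (v : Z -> M) :
  sat v (rank_form k theta) <->
  rank_ge_on phi psi k [set a | sat (valsum a v) theta].
Proof.
elim: k Z theta v => [|k IH] Z theta v /=; first by rewrite sat_Exs.
have addE chi b : [set a | sat (valsum a (valsum b v))
      (And (inst theta inr) (inst chi inl))] =
    [set a | sat (valsum a v) theta] `&` [set a | sat (valsum a b) chi].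
  by apply/seteqP; split=> a /=; rewrite !sat_inst.
rewrite sat_Exs; split=> -[b H]; exists b; move: H; by rewrite /= !IH !addE.
Qed.

End Definability.

(** * Definability of types *)

Lemma rank_self_equal (L : signature) (M : structure L) n m
    (phi psi : form L ('I_n + 'I_m)) :
  rlt (rank M phi psi [set self_equal L n [set: M]]) (ROrd omega) <->
  exists k, ~ rank_ge_on phi psi k [set: 'I_n -> M].
Proof.
have E k : rank_ge phi psi (iter k osucc ozero) [set self_equal L n [set: M]] <->
    rank_ge_on phi psi k [set: 'I_n -> M].
  rewrite rank_ge_realizations; last exact: finite_set1.
  suff -> : realizations [set self_equal L n [set: M]] = setT by [].
  apply/seteqP; split=> // a _ chi ->; rewrite /self_equal.
  by elim: (enum 'I_n) => [|i s IH] //=.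
by rewrite rank_lt_omega; split=> -[k nk]; exists k; move: nk; rewrite E.
Qed.

(** Allows families of formulas in any countable set of variables to be indexed by [form_classes T],
    hence bounded by |T|. *)
Lemma form_representatives (L : signature) (T : theory L) (W : countType) :
  exists rep : form_classes T -> form L W,
    forall psi, exists c, equivalent T psi (rep c).
Proof.
have /choice[rep repP] : forall c : form_classes T, exists chi : form L W,
    forall psi, val c (rename pickle psi) -> equivalent T psi chi.
  move=> c; have [[chi cchi]|nc] := pselect (exists chi : form L W, val c (rename pickle chi)).
    exists chi => psi cpsi N TN v.
    have [phi _ phic] : range (fun phi : form L nat => [set psi | equivalent T phi psi]) (val c).
      exact/set_mem/valP.
    have [n0] := carrier_inhabited N.
    (* Extends [v] along [pickle], with [n0] at the numbers that code no variable. *)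
    pose v' k := if unpickle k is Some w then v w else n0.
    have v'E : v' \o pickle = v by apply/funext => w; rewrite /v' /= pickleK.
    move: cchi cpsi; rewrite -phic => /(_ N TN v') + /(_ N TN v').
    by rewrite !sat_rename v'E => -> ->.
  by exists Top => psi cpsi; case: nc; exists psi.
exists rep => psi; pose A := [set chi | equivalent T (rename pickle psi) chi].
have cA : form_classes T A by exists (rename pickle psi).
exists (SigSub (mem_set cA)); apply: repP => N TN v; exact: iff_refl.
Qed.

Section RankDefinability.
Variables (L : signature) (T : theory L) (M : structure L).
Hypotheses (hJCP : JCP T) (pcM : pc_model T M).
Variables (n m : nat) (phi : form L ('I_n + 'I_m)) (a : 'I_n -> M) (B : set M).

(* Take [k] least such that some formula [theta] of the type [tp(a/B)] has
   finite rank less than [k]; [chi(y)] says that the rank of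
   [theta(x) /\ phi(x, y)] is at least [k - 1]. *)
Lemma separating_form (psi : form L ('I_n + 'I_m)) k :
  ~ rank_ge_on phi psi k [set: 'I_n -> M] ->
  exists chi : form L ('I_m + B), forall b : 'I_m -> B,
    (sat (valsum a (val \o b)) phi -> sat (valsum (val \o b) val) chi) /\
    (sat (valsum a (val \o b)) psi -> ~ sat (valsum (val \o b) val) chi).
Proof.
move=> nk.
pose S (theta : form L ('I_n + B)) := [set a' : 'I_n -> M | sat (valsum a' val) theta].
pose P k := `[< exists theta, S theta a /\ ~ rank_ge_on phi psi k (S theta) >].
have exP : exists k, P k.
  by exists k; apply/asboolP; exists Top.
(* The least bound is not 0, since [a] realizes [theta]. With the bound [j + 1], minimality gives
   every formula of the type rank at least [j]. *)
case: (ex_minnP exP) => -[|j] /asboolP[theta [thetaa ntheta]] jmin.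
  by case: ntheta; exists a.
have rankj th : S th a -> rank_ge_on phi psi j (S th).
  move=> tha; apply: contrapT => nth.
  have Pj : P j by apply/asboolP; exists th.
  by have := jmin _ Pj; rewrite ltnn.
pose lift (chi : form L ('I_n + 'I_m)) : form L ('I_n + ('I_m + B)) :=
  And (inst theta inr) (inst chi inl).
have liftE chi b : [set a' | sat (valsum a' (valsum (val \o b) val)) (lift chi)] =
    S theta `&` [set a' | sat (valsum a' (val \o b)) chi].
  by apply/seteqP; split=> a' /=; rewrite !sat_inst.
have rankE chi (b : 'I_m -> B) : sat (valsum a (val \o b)) chi ->
    rank_ge_on phi psi j (S theta `&` [set a' | sat (valsum a' (val \o b)) chi]).
  move=> chib; pose th := And theta (inst chi b).
  suff -> : S theta `&` [set a' | sat (valsum a' (val \o b)) chi] = S th.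
    by apply: rankj; split=> //; apply/sat_inst.
  by apply/seteqP; split=> a'; rewrite /S /th /= sat_inst.
exists (rank_form phi psi j (lift phi)) => b; rewrite sat_rank_form liftE.
split=> [|psib phib]; first exact: rankE.
(* If [psi] and the separating formula both held at [b], then [b] would split [theta] into two parts
   of rank at least [j], giving it rank at least [j + 1]. *)
by apply: ntheta; exists (val \o b); split=> //; exact: rankE.
Qed.

Lemma definable_of_rank :
  (forall psi, contradictory T phi psi ->
     exists k, ~ rank_ge_on phi psi k [set: 'I_n -> M]) ->
  exists d : set (form L ('I_m + B)), d #<= form_classes T /\
    forall b : 'I_m -> B, sat (valsum a (val \o b)) phi <->
      (forall theta, d theta -> sat (valsum (val \o b) val) theta).
Proof.
move=> fin_rank; have TM := pcM.1.
have [rep repP] := form_representatives T ('I_n + 'I_m)%type.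
have /choice[chi chiP] : forall c, exists chi : form L ('I_m + B),
    contradictory T phi (rep c) -> forall b : 'I_m -> B,
    (sat (valsum a (val \o b)) phi -> sat (valsum (val \o b) val) chi) /\
    (sat (valsum a (val \o b)) (rep c) -> ~ sat (valsum (val \o b) val) chi).
  move=> c; have [ctr|nctr] := pselect (contradictory T phi (rep c)); last by exists Top.
  by have [k /separating_form[chi chiP]] := fin_rank _ ctr; exists chi.
exists (chi @` [set c | contradictory T phi (rep c)]); split.
  apply: card_le_trans (card_image_le _ _) _.
  by rewrite -(card_le_eqr (card_setT _)); exact: card_leT.
move=> b; split=> [phib _ [c ctr <-]|H]; first exact: (chiP c ctr b).1.
(* If [phi] failed at [b], some contradictory [psi] would hold there, and the formula of [d]
   attached to the representative of [psi] would fail. *)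
apply: contrapT => /(pc_model_contradictory hJCP pcM)[psi [ctr psib]].
have [c psic] := repP psi.
have ctrc : contradictory T phi (rep c).
  by move=> N TN v [phiv /(psic N TN) psiv]; exact: (ctr N TN v (conj phiv psiv)).
apply: (chiP c ctrc b).2; first exact/psic.
by apply: H; exists c.
Qed.

End RankDefinability.

(** Each formula depends on finitely many variables, which reduces an arbitrary tuple to a finite
    one. *)
Lemma definable_of_rank_lt_omega (L : signature) (T : theory L) (M : structure L) :
  JCP T -> pc_model T M ->
  (forall (n m : nat) (phi psi : form L ('I_n + 'I_m)),
     contradictory T phi psi ->
     rlt (rank M phi psi [set self_equal L n [set: M]]) (ROrd omega)) ->
  forall (V : Type) (B : set M) (p : set (form L (V + B))),
    types V B p -> definable T p.
Proof.
move=> hJCP pcM rank_fin V B p [a _ <-] m phi.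
have [n [phi' [s phiE]]] := form_finite_vars phi.
have [psi ctr|d [dT dP]] := @definable_of_rank _ _ _ hJCP pcM n m phi' (a \o s) B.
  exact/rank_self_equal/rank_fin.
exists d; split=> // b; rewrite -dP -phiE; exact: sat_inst.
Qed.

(** * Counting types *)

Section Tree.
Variables (L : signature) (M : structure L) (X Y : Type).
Variables phi psi : form L (X + Y).
Variables (lambda : eqType) (lt : lambda -> lambda -> Prop).
Hypothesis lt_asym : forall x y, lt x y -> ~ lt y x.
Hypothesis lt_min : forall A : set lambda, A !=set0 ->
  exists x, A x /\ forall y, A y -> y <> x -> lt x y.

Definition segment x := [set y | lt y x].

Definition branch_form (eta : set lambda) (x : lambda) : form L (X + Y) :=
  if `[< eta x >] then phi else psi.

Lemma rank_ge_on_nonempty k (S : set (X -> M)) : rank_ge_on phi psi k S -> S !=set0.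
Proof.
elim: k S => [//|k IH] S /= [b [/IH[a [Sa _]] _]]; by exists a.
Qed.

(** Here [c x s] is the parameter at level [x] after the path [s]. The least level of [F] becomes
    the root, and the induction builds the other levels separately inside the two halves of [S]. *)
Lemma rank_tree k (S : set (X -> M)) (F : seq lambda) :
  size F <= k -> rank_ge_on phi psi k S ->
  exists c : lambda -> set lambda -> Y -> M, forall eta, exists a, S a /\
    forall x, x \in F ->
      sat (valsum a (c x (eta `&` segment x))) (branch_form eta x).
Proof.
elim: k S F => [|k IH] S F.
  rewrite leqn0 => /nilP -> [a Sa]; have [m0] := carrier_inhabited M.
  by exists (fun _ _ _ => m0) => eta; exists a.
move=> Fk rS; have [nilF|] := pselect ([set` F] !=set0); last first.
  move=> nF; have [a Sa] := rank_ge_on_nonempty rS.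
  have [m0] := carrier_inhabited M.
  by exists (fun _ _ _ => m0) => eta; exists a; split=> // x xF; case: nF; exists x.
have [x [/= xF xmin]] := lt_min nilF.
have [b [r1 r2]] := rS.
have F'k : size [seq y <- F | y != x] <= k.
  rewrite size_filter -ltnS; apply: leq_trans Fk.
  rewrite -(count_predC (pred1 x) F) -[X in X < _]add0n ltn_add2r.
  by rewrite -has_count has_pred1.
have [c1 c1P] := IH _ _ F'k r1; have [c2 c2P] := IH _ _ F'k r2.
(* Above the root, membership of [x] in the path selects the subtree. The path to a level [y] of [F]
   above [x] does record this, as [x] precedes [y]. *)
exists (fun y s => if y == x then b else if `[< s x >] then c1 y s else c2 y s) => eta.
have seg y : y \in F -> y != x -> `[< (eta `&` segment y) x >] = `[< eta x >].
  move=> yF /eqP yx; apply/asbool_equiv_eq; split=> [[]|etax] //.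
  by split=> //; exact: xmin.
have [etax|netax] := pselect (eta x).
  have [a [[Sa phia] aP]] := c1P eta; exists a; split=> // y yF.
  have [->|yx] := eqVneq y x; first by rewrite /branch_form asboolT.
  by rewrite seg // asboolT //; apply: aP; rewrite mem_filter yx.
have [a [[Sa phia] aP]] := c2P eta; exists a; split=> // y yF.
have [->|yx] := eqVneq y x; first by rewrite /branch_form asboolF.
by rewrite seg // asboolF //; apply: aP; rewrite mem_filter yx.
Qed.

(** The segment of the least element whose segment has too many subsets, if there is one; otherwise
    all of [lambda], by [cantor]. *)
Lemma minimal_power : exists D : set lambda,
  ~ ([set A : set lambda | A `<=` D] #<= [set: lambda]) /\
  forall x, D x -> [set A : set lambda | A `<=` segment x] #<= [set: lambda].
Proof.
pose bad x := ~ ([set A : set lambda | A `<=` segment x] #<= [set: lambda]).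
have [/lt_min[x [badx xmin]]|nbad] := pselect ([set x | bad x] !=set0).
  exists (segment x); split=> // y yx; apply: contrapT => bady.
  apply: (lt_asym yx); apply: xmin => // yx'; rewrite yx' in yx.
  exact: (lt_asym yx yx).
exists setT; split; first exact: cantor.
by move=> x _; apply: contrapT => badx; apply: nbad; exists x.
Qed.

End Tree.

Section StableRank.
Variables (L : signature) (T : theory L) (kappa : Type) (M : structure L).
Hypotheses (TM : model T M) (satM : saturated kappa M).
Variables (n m : nat) (phi psi : form L ('I_n + 'I_m)).
Hypothesis ctr : contradictory T phi psi.
Variable lambda : eqType.
Hypotheses (linf : infinite_set [set: lambda]) (lsmall : small kappa [set: lambda]).

Lemma many_types :
  (forall k, rank_ge_on phi psi k [set: 'I_n -> M]) ->
  exists B : set M, B #<= [set: lambda] /\ ~ (types 'I_n B #<= [set: lambda]).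
Proof.
move=> rank_inf.
have [lt [lt_asym lt_min]] := well_founded_order lambda.
have [D [Dbig Dsmall]] := minimal_power lt_asym lt_min.
pose seg := segment lt.
pose node := [set p : lambda * set lambda | D p.1 /\ p.2 `<=` seg p.1].
have nodeP (eta : set lambda) (x : D) : node (val x, eta `&` seg (val x)).
  by split; [exact/set_mem/valP|exact: subIsetr].
pose nu eta (x : D) : node := SigSub (mem_set (nodeP eta x)).
pose V := (node * 'I_m)%type.
have [l0] : inhabited lambda by have [x] := infinite_setN0 linf.
have V_le : [set: V] #<= [set: lambda].
  apply: card_le_prod_infinite => //; last exact: card_le_ord.
  rewrite (card_le_eql (card_setT _)).
  apply: card_le_trans (card_square linf).
  have /choice[f fP] : forall x, exists f : set lambda -> lambda, D x ->
      set_inj [set A : set lambda | A `<=` seg x] f.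
    move=> x; have [/Dsmall/(card_le_fun l0)[f [_ finj]]|nD] := pselect (D x).
      by exists f.
    by exists (fun=> l0).
  apply: (@card_image_le_inj _ _ _ _ (fun p => (p.1, f p.1 p.2))) => //.
  move=> [x A] [y B] [/= Dx Ax] [/= _ By] [xy]; rewrite -xy in By *.
  by move=> /(fP x Dx) -> //; rewrite inE.
have smallV : small kappa [set: V] := small_le V_le lsmall.
pose cell eta (x : D) := branch_form phi psi eta (val x).
(* The quantifier hides the realization of the branch, so saturation solves for the node parameters
   alone, for all branches at once. *)
pose branch eta (F : seq D) : form L (V + (set0 : set M)) :=
  Exs (Ands F (fun x => inst (cell eta x) (fun i => inl (nu eta x, i)))).
pose Sigma := [set theta | exists eta F, theta = branch eta F].
have consSigma : consistent Sigma.
  move=> Delta fDelta DS.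
  have [|l lP] := @finite_union_seq _ _ Delta (fun theta F => exists eta, theta = branch eta F) fDelta.
    by move=> theta /DS[eta [F ->]]; exists F, eta.
  (* Finitely many formulas of [Sigma] involve only the levels in [l], and a tree on these levels
     realizes every branch. *)
  have [c cP] := rank_tree lt_min (leqnn (size (map val l))) (rank_inf _).
  exists (fun vi => c (val vi.1).1 (val vi.1).2 vi.2) => theta /lP[F [[eta ->] Fl]].
  apply/sat_Exs; have [a [_ aP]] := cP eta; exists a.
  apply/sat_Ands => x xF; apply/sat_inst; apply: aP.
  by apply: map_f; exact: Fl.
have [e eP] := satM smallV (small_le (card_ge0 _ _) lsmall) consSigma.
pose B := range e.
have B_le : B #<= [set: lambda] by apply: card_le_trans V_le; exact: card_image_le.
have eB v : B (e v) by exists v.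
pose par eta (x : D) (i : 'I_m) : B := SigSub (mem_set (eB (nu eta x, i))).
pose p0 eta := [set theta : form L ('I_n + B) | exists x, theta = inst (cell eta x) (par eta x)].
(* A second use of saturation: the finite parts of each branch are realized, hence the whole branch
   is. *)
have p0_real eta : exists a : 'I_n -> M, forall theta, p0 eta theta -> sat (valsum a val) theta.
  apply: satM; [|exact: small_le B_le lsmall|].
    by apply: small_le lsmall; exact: card_le_ord.
  move=> Delta fDelta DS.
  have [|l lP] := @finite_union_seq _ _ Delta
      (fun theta F => exists x, x \in F /\ theta = inst (cell eta x) (par eta x)) fDelta.
    by move=> theta /DS[x ->]; exists [:: x], x; rewrite inE eqxx.
  have /eP /sat_Exs[a /sat_Ands aP] : Sigma (branch eta l) by exists eta, l.
  exists a => theta /lP[F [[x [xF ->]] Fl]].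
  by have /sat_inst := aP x (Fl _ xF); move=> H; apply/sat_inst.
have /choice[a aP] := p0_real.
(* Branches that agree below [x] meet the same parameter at [x], where one realization satisfies
   [phi] and the other [psi]. *)
have separate eta eta' (x : D) : eta (val x) -> ~ eta' (val x) ->
    (forall y, seg (val x) y -> eta y <-> eta' y) -> tp (a eta) (B := B) <> tp (a eta') (B := B).
  move=> etax neta'x agree tpE.
  have nuE : nu eta' x = nu eta x.
    apply: val_inj => /=; congr pair; apply/seteqP.
    by split=> y [] /= ey sy; split=> //; apply/(agree y sy).
  have parE : par eta' x = par eta x by apply/funext => i; rewrite /par; apply: val_inj; rewrite /= nuE.
  have : tp (a eta) (B := B) (inst phi (par eta x)).
    by apply: aP; exists x; rewrite /cell /branch_form asboolT.
  rewrite tpE => /sat_inst phia.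
  have /aP /sat_inst : p0 eta' (inst psi (par eta' x)).
    by exists x; rewrite /cell /branch_form asboolF.
  rewrite parE => psia; exact: (ctr TM (conj phia psia)).
exists B; split=> // types_le; apply: Dbig; apply: card_le_trans types_le.
apply: (@card_image_le_inj _ _ _ _ (fun eta => tp (a eta) (B := B))).
  by move=> eta _; exists (a eta).
move=> eta eta' etaD eta'D tpE; apply: contrapT => neq.
have [|x [/= xneq xmin]] := lt_min [set x | ~ (eta x <-> eta' x)].
  apply: contrapT => nx; apply: neq; apply/funext => x; apply/propext.
  by apply: contrapT => nex; apply: nx; exists x.
have agree y : seg x y -> eta y <-> eta' y.
  move=> yx; apply: contrapT => ny; apply: (lt_asym _ _ yx); apply: xmin => // yx'.
  by rewrite yx' in yx; exact: (lt_asym _ _ yx yx).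
have Dx : D x.
  by apply: contrapT => nDx; apply: xneq; split=> [/etaD|/eta'D].
pose x' : D := SigSub (mem_set Dx).
have [ex|nex] := pselect (eta x); have [e'x|ne'x] := pselect (eta' x).
- exact: xneq.
- exact: (@separate eta eta' x').
- by apply: (@separate eta' eta x') => // y /agree ->.
- exact: xneq.
Qed.

End StableRank.

Lemma rank_lt_omega_of_stable (L : signature) (T : theory L) (kappa : Type)
    (M : structure L) : model T M -> saturated kappa M -> stable M kappa ->
  forall (n m : nat) (phi psi : form L ('I_n + 'I_m)), contradictory T phi psi ->
  rlt (rank M phi psi [set self_equal L n [set: M]]) (ROrd omega).
Proof.
move=> TM satM [lambda []]; elim/Peq: lambda => lambda linf lsmall lstab n m phi psi ctr.
apply/rank_self_equal; apply: contrapT => /forallNP nrank.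
have [|B [/lstab Bl]] := many_types TM satM ctr linf lsmall.
  by move=> k; apply: contrapT; exact: nrank.
by apply; exact: Bl.
Qed.

(** * Few types from definability *)

Lemma form_classes_infinite (L : signature) (T : theory L) (M : structure L) (x y : M) :
  model T M -> x <> y -> infinite_set [set: form_classes T].
Proof.
move=> TM xy; apply/infiniteP/card_le_typeP.
(* Sending the variable [j + 1] to [y] and the others to [x] refutes [chi j] but satisfies every
   other [chi k]. *)
pose chi k : form L nat := Equal (Var L 0) (Var L k.+1).
have cP k : form_classes T [set psi | equivalent T (chi k) psi] by exists (chi k).
exists (fun k => SigSub (mem_set (cP k))) => j k /(congr1 val) /= E.
have : [set psi | equivalent T (chi j) psi] (chi k).
  by rewrite E => N TN v; exact: iff_refl.
move=> /(_ M TM (fun i => if i == j.+1 then y else x)) /= [_].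
rewrite eqxx eqSS; case: eqVneq => [->//|_] H.
by case: xy; exact: H.
Qed.

Section DefinableStable.
Variables (L : signature) (T : theory L) (M : structure L) (TM : model T M).
Variables (lambda : Type) (n : nat) (B : set M).
Hypotheses (linf : infinite_set [set: lambda])
  (lpow : [set: form_classes T -> lambda] #<= [set: lambda])
  (Bl : B #<= [set: lambda])
  (defB : forall p, types 'I_n B p -> definable T p).

Local Notation C := (form_classes T).

(** A type is determined by a map [H] listing codes of its definitions, one list for each length [k]
    and each class of formulas. Such maps go from a set of size at most |T| to at most [lambda]
    codes. *)
Lemma types_le_of_definable : types 'I_n B #<= [set: lambda].
Proof.
have [m0] := carrier_inhabited M.
have [l0 _] := infinite_setN0 linf.
(* With a single element in [M] there is only one tuple. With two, [C] is infinite and absorbs the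
   factor [nat]. *)
have [[x [y xy]]|M1] := pselect (exists x y : M, x <> y); last first.
  apply: card_le_trans (card_image_le _ _) _.
  apply/card_le_typeP; exists (fun=> l0) => a a' _; apply/funext => i.
  by apply: contrapT => aa'; apply: M1; exists (a i), (a' i).
have Cinf := form_classes_infinite TM xy.
have C_le : [set: C] #<= [set: lambda].
  apply: card_le_trans lpow.
  have /infiniteP/card_le_typeP[e einj] := linf.
  apply/card_le_typeP; exists (fun c c' => if pselect (c = c') then e 1 else e 0) => c c'.
  move=> /(congr1 (fun f => f c')) /=; case: (pselect (c' = c')) => // cc /=.
  by case: pselect => // ncc /= /einj.
(* A formula over [B] is coded by the class of a formula with slots numbered by [nat] and the list
   of parameters filling them; slots past the list receive [m0]. *)
pose K := (C * seq B)%type.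
have K_le : [set: K] #<= [set: lambda].
  apply: card_le_prod_infinite => //; apply: card_le_seq => //.
  by rewrite (card_le_eql (card_setT _)).
pose rep k := projT1 (cid (form_representatives T ('I_n + 'I_k)%type)).
have repP k := projT2 (cid (form_representatives T ('I_n + 'I_k)%type)).
pose repB k := projT1 (cid (form_representatives T ('I_k + nat)%type)).
have repBP k := projT2 (cid (form_representatives T ('I_k + nat)%type)).
pose E k (c : K) (b : 'I_k -> M) :=
  sat (valsum b (nth m0 (map val c.2))) (repB k c.1).
have code k (theta : form L ('I_k + B)) : exists c : K, forall b : 'I_k -> M,
    sat (valsum b val) theta <-> E k c b.
  have [k' [theta' [s thetaE]]] := form_finite_params theta.
  have [c cE] := repBP k (inst theta' val).
  exists (c, [seq s i | i <- enum 'I_k']) => b.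
  rewrite thetaE /E /= -(cE _ TM) sat_inst.
  suff -> : nth m0 [seq val i | i <- [seq s i | i <- enum 'I_k']] \o val = val \o s by [].
  apply/funext => i /=; rewrite -map_comp (nth_map i) ?size_enum_ord //.
  by rewrite nth_ord_enum.
pose defines (a : 'I_n -> M) (H : (nat * C) * C -> K) := forall k c (b : 'I_k -> B),
  sat (valsum a (val \o b)) (rep k c) <-> forall c1, E k (H (k, c, c1)) (val \o b).
have /choice[H HP] : forall a, exists H, defines a H.
  move=> a.
  suff /choice[h hP] : forall kc : nat * C, exists h : C -> K, forall b : 'I_kc.1 -> B,
      sat (valsum a (val \o b)) (rep kc.1 kc.2) <-> forall c1, E kc.1 (h c1) (val \o b).
    by exists (fun z => h z.1 z.2) => k c b; exact: (hP (k, c)).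
  move=> [k c] /=.
  have [d [dC dP]] : exists d : set (form L ('I_k + B)),
      is_def T (tp a (B := B)) (rep k c) d.
    have tpa : types 'I_n B (tp a (B := B)) by exists a.
    exact: (defB tpa (rep k c)).
  (* A definition may have fewer formulas than there are classes; the remaining indices are padded
     with a code of [Top]. *)
  have [top topE] := code k Top.
  have /choice[cd cdE] := code k.
  have /card_le_injP[i iinj] := dC.
  have /choice[h hP] : forall c1, exists x : K,
      (forall theta, i theta = c1 -> x = cd (val theta)) /\
      ((forall theta, i theta <> c1) -> x = top).
    move=> c1; have [[theta ic1]|ni] := pselect (exists theta, i theta = c1).
      exists (cd (val theta)); split=> [th' ith'|/(_ theta)//].
      by rewrite -ith' in ic1; rewrite (iinj _ _ ic1).
    by exists top; split=> // theta ith; case: ni; exists theta.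
  exists h => b; rewrite -sat_inst; rewrite -[sat _ _]/(tp a (B := B) _) dP.
  split=> [dtheta c1|hE theta dtheta].
    have [[theta ic1]|ni] := pselect (exists theta, i theta = c1).
      rewrite ((hP c1).1 _ ic1) -cdE; apply: dtheta; exact/set_mem/valP.
    rewrite (hP c1).2; first exact/topE.
    by move=> theta ith; apply: ni; exists theta.
  have := hE (i (SigSub (mem_set dtheta))).
  by rewrite ((hP _).1 _ erefl) -cdE.
(* Up to equivalence, a formula over [B] is an instance of a representative, so [H] decides whether
   it lies in the type. *)
have tpE a a' : H a = H a' -> tp a (B := B) = tp a' (B := B).
  move=> HE; apply/funext => theta; apply/propext; rewrite /tp /=.
  have [k [theta' [b thetaE]]] := form_finite_params theta.
  have [c cE] := repP k theta'.
  by rewrite !thetaE !(cE _ TM) (HP a k c b) (HP a' k c b) HE.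
have /choice[g gP] : forall p, exists a, types 'I_n B p -> tp a (B := B) = p.
  move=> p; have [[a _ ap]|np] := pselect (types 'I_n B p); first by exists a.
  by exists (fun=> m0).
apply: card_le_trans lpow.
have : [set: (nat * C) * C -> K] #<= [set: C -> lambda].
  apply: card_le_arrow => //; apply: card_le_prod_infinite => //.
  by apply: card_le_prod_infinite => //; exact/infiniteP.
apply: card_le_trans.
apply: (@card_image_le_inj _ _ _ _ (fun p => H (g p))) => // p q pB qB /tpE.
by rewrite !gP.
Qed.

End DefinableStable.

Theorem theorem6p17 (L : signature) (T : theory L) (kappa : Type)
    (M : structure L) (hJCP : JCP T) (hM : monster T kappa M) :
  [<-> stable M kappa;
       forall (n m : nat) (phi psi : form L ('I_n + 'I_m)),
         contradictory T phi psi ->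
         rlt (rank M phi psi [set self_equal L n [set: M]]) (ROrd omega);
       forall (V : Type) (B : set M) (p : set (form L (V + B))),
         small kappa [set: V] -> small kappa B ->
         types V B p -> definable T p;
       forall lambda : Type,
         infinite_cardinal lambda -> small kappa [set: lambda] ->
         [set: form_classes T -> lambda] #= [set: lambda] ->
         lambda_stable M lambda].
Proof.
have [pcM large satM _] := hM; have [TM _] := pcM.
tfae.
- exact: rank_lt_omega_of_stable.
- move=> rank_fin V B p _ _; exact: definable_of_rank_lt_omega.
- move=> def lambda linf lsmall /card_eqPle[lpow _] B Bl n.
  apply: (types_le_of_definable TM linf lpow Bl) => p; apply: def.
    by apply: small_le lsmall; exact: card_le_ord.
  exact: small_le lsmall.
- move=> lstab.
  have [|linf lpow] := @card_arrow_pow (form_classes T).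
    have cP : form_classes T [set psi | equivalent T Top psi] by exists Top.
    by exists; exact: SigSub (mem_set cP).
  (* The lower bound on [kappa] in [monster] makes this cardinal small. *)
  by exists ((form_classes T + nat)%type -> bool); split=> //; exact: lstab.
Qed.
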